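(* Let $K_1\in\mathcal{B}(H)$, $K_2\in\mathcal{B}(X)$, $T,T_1\in\mathcal{GB}(H)$ and $U,U_1\in\mathcal{GB}(X)$. Let $\Lambda_{TT_1}=\{(W_j,\Lambda_j,v_j)\}_{j\in J}$ be a $(T,T_1)$-controlled $K_1$-$g$-fusion frame for $H$ with bounds $A,B$, and let $\Gamma_{UU_1}=\{(V_j,\Gamma_j,v_j)\}_{j\in J}$ be a $(U,U_1)$-controlled $K_2$-$g$-fusion frame for $X$ with bounds $C,D$, with corresponding frame operators $S_C$ and $S_{C'}$. Suppose that (i) $W\in\mathcal{B}(H)$ and $V\in\mathcal{B}(X)$ are invertible operators on $H$ and $X$, respectively; (ii) $W^*$ commutes with $T$ and $T_1$, and $V^*$ commutes with $U$ and $U_1$; (iii) $K_1$ commutes with $W$ and $K_2$ commutes with $V$. Then $$\Delta=\{((W\oplus V)(W_j\oplus V_j),\ (\Lambda_j\oplus\Gamma_j)P_{W_j\oplus V_j}(W^*\oplus V^* ),\ v_j)\}_{j\in J}$$ is a $(T\oplus U,\ T_1\oplus U_1)$-controlled $K_1\oplus K_2$-$g$-fusion frame for $H\oplus X$ with corresponding frame operator $(W\oplus V)(S_C\oplus S_{C'})(W\oplus V)^*$.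
   Context: $H$ and $X$ are separable Hilbert spaces, $J\subset\mathbb{Z}$, $\{H_j\}_{j\in J}$ and $\{X_j\}_{j\in J}$ are collections of Hilbert spaces, $W_j\subset H$ and $V_j\subset X$ are closed subspaces (not to be confused with the operators $W$, $V$), $v_j>0$ are weights, $\Lambda_j\in\mathcal{B}(H,H_j)$ and $\Gamma_j\in\mathcal{B}(X,X_j)$. $\mathcal{B}$ denotes bounded linear operators and $\mathcal{GB}(H)$ the operators in $\mathcal{B}(H)$ having a bounded inverse. $P_M$ is the orthogonal projection onto a closed subspace $M$. $H\oplus X=\{f\oplus g=(f,g): f\in H, g\in X\}$ is the Hilbert space with inner product $\langle f\oplus g,f'\oplus g'\rangle=\langle f,f'\rangle_H+\langle g,g'\rangle_X$ and the norm it induces. For bounded operators $R:H\to Z$ and $R':X\to Y$ ($Z,Y$ Hilbert spaces), $R\oplus R':H\oplus X\to Z\oplus Y$ is $(R\oplus R')(f\oplus g)=(Rf,R'g)$; in particular $\Lambda_j\oplus\Gamma_j\in\mathcal{B}(H\oplus X,H_j\oplus X_j)$. For a Hilbert space $E$, $K\in\mathcal{B}(E)$, and $R,R'\in\mathcal{GB}(E)$, a family $\{(M_j,\Theta_j,v_j)\}_{j\in J}$ ($M_j\subset E$ closed subspaces, $\Theta_j$ bounded operators from $E$ to Hilbert spaces, $v_j>0$) is an $(R,R')$-controlled $K$-$g$-fusion frame for $E$ with bounds $a,b$ if $0<a\le b<\infty$ and $$a\|K^*e\|^2\le\sum_{j\in J}v_j^2\langle\Theta_jP_{M_j}R'e,\Theta_jP_{M_j}Re\rangle\le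 b\|e\|^2\quad\text{for all } e\in E;$$ it is an $(R,R')$-controlled $K$-$g$-fusion frame if such $a,b$ exist. Its frame operator is $e\mapsto\sum_{j\in J}v_j^2R^*P_{M_j}\Theta_j^*\Theta_jP_{M_j}R'e$. *)

(* Defs.v *)
From HB Require Import structures.
From mathcomp Require Import all_boot all_order all_algebra finmap.
From mathcomp Require Import complex sesquilinear.
From mathcomp Require Import all_classical all_reals all_analysis.
From mathcomp Require Import summability ring.

Set Implicit Arguments.
Unset Strict Implicit.
Unset Printing Implicit Defensive.
Import Order.TTheory GRing.Theory Num.Theory.
Import numFieldNormedType.Exports.
Local Open Scope classical_set_scope.
Local Open Scope ring_scope.

(* A [{dot V for Num.conj}] is linear in its first argument and conjugate-linear
   in its second one. *)
HB.mixin Record isHilbert (C : numClosedFieldType) V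
    & CompleteNormedModule C V := {
  hinner : {dot V for Num.conj};
  sqr_norm_hinner : forall x : V, `|x| ^+ 2 = hinner x x
}.

#[short(type="hilbertType")]
HB.structure Definition Hilbert (C : numClosedFieldType) :=
  {V of CompleteNormedModule C V & isHilbert C V}.

(* The carrier is the cartesian product, under an alias because the product
   already has the max norm as canonical norm. *)
Definition hsum (C : numClosedFieldType) (H X : hilbertType C) : Type :=
  (H * X)%type.

Section DirectSum.
Variables (C : numClosedFieldType) (H X : hilbertType C).

HB.instance Definition _ := GRing.Lmodule.on (hsum H X).

Definition hsum_inner (z w : hsum H X) : C :=
  hinner z.1 w.1 + hinner z.2 w.2.

Let hsum_bilinear :
  bilinear_for *%R (Num.conj \; *%R : C -> C -> C) hsum_inner.
Proof.
split=> w a u v; rewrite /hsum_inner /=.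
  by rewrite !linearPl /= !mulrDr addrACA.
by rewrite !linearPr /= !mulrDr addrACA.
Qed.

HB.instance Definition _ := bilinear_isBilinear.Build C (hsum H X) (hsum H X) C
  *%R (Num.conj \; *%R) hsum_inner hsum_bilinear.

Let hsum_hermitian (z w : hsum H X) :
  hsum_inner z w = (-1) ^+ false * (hsum_inner w z)^*.
Proof.
rewrite /hsum_inner [hinner z.1 _]hermC [hinner z.2 _]hermC !expr0 !mul1r.
by rewrite rmorphD.
Qed.

HB.instance Definition _ := isHermitianSesquilinear.Build
  C (hsum H X) false Num.conj hsum_inner hsum_hermitian.

Let hsum_inner_gt0 (z : hsum H X) : z != 0 -> 0 < hsum_inner z z.
Proof.
case: z => f g /= z0; rewrite /hsum_inner /= lt_def addr_ge0// andbT.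
rewrite paddr_eq0// !dnorm_eq0; apply: contra z0 => /andP[/eqP -> /eqP ->].
exact: eqxx.
Qed.

HB.instance Definition _ :=
  isDotProduct.Build C (hsum H X) hsum_inner hsum_inner_gt0.

Definition hsum_norm (z : hsum H X) : C := sqrtC (hsum_inner z z).

Let hsum_normE z : hsum_norm z = sqrtC (`|z.1| ^+ 2 + `|z.2| ^+ 2).
Proof. by rewrite /hsum_norm /hsum_inner !sqr_norm_hinner. Qed.

Let sqr_hsum_norm z : hsum_norm z ^+ 2 = `|z.1| ^+ 2 + `|z.2| ^+ 2.
Proof. by rewrite hsum_normE sqrtCK. Qed.

Let hsum_norm_ge0 z : 0 <= hsum_norm z.
Proof. by rewrite hsum_normE sqrtC_ge0 addr_ge0// exprn_ge0. Qed.

Let ler_hsum_normD z w : hsum_norm (z + w) <= hsum_norm z + hsum_norm w.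
Proof.
rewrite -ler_sqr ?nnegrE ?addr_ge0// sqrrD !sqr_hsum_norm.
have [a0 b0] := (normr_ge0 z.1, normr_ge0 w.1).
have [c0 d0] := (normr_ge0 z.2, normr_ge0 w.2).
have : `|z.1| * `|w.1| + `|z.2| * `|w.2| <= hsum_norm z * hsum_norm w.
  rewrite -ler_sqr ?nnegrE ?addr_ge0 ?mulr_ge0//.
  rewrite exprMn !sqr_hsum_norm -subr_ge0.
  set a := `|z.1|; set b := `|w.1|; set c := `|z.2|; set d := `|w.2|.
  rewrite (_ : _ - _ = (a * d - b * c) ^+ 2); last by ring.
  by rewrite real_exprn_even_ge0// rpredB// rpredM// ger0_real.
move=> CS.
have := lerD (lerXn2r 2 (normr_ge0 (z.1 + w.1)) (addr_ge0 a0 b0)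
  (ler_normD z.1 w.1))
  (lerXn2r 2 (normr_ge0 (z.2 + w.2)) (addr_ge0 c0 d0) (ler_normD z.2 w.2)).
move/le_trans; apply.
rewrite !sqrrD -subr_ge0.
rewrite (_ : _ - _ = (hsum_norm z * hsum_norm w
   - (`|z.1| * `|w.1| + `|z.2| * `|w.2|)) *+ 2); last by ring.
by rewrite mulrn_wge0// subr_ge0.
Qed.

Let hsum_normZ (l : C) z : hsum_norm (l *: z) = `|l| * hsum_norm z.
Proof.
by rewrite /hsum_norm dnormZ sqrtCM ?nnegrE ?exprn_ge0// ?sqrCK.
Qed.

Let hsum_norm0_eq0 z : hsum_norm z = 0 -> z = 0.
Proof. by move/eqP; rewrite sqrtC_eq0 dnorm_eq0 => /eqP. Qed.

HB.instance Definition _ := Lmodule_isNormed.Build C (hsum H X)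
  ler_hsum_normD hsum_normZ hsum_norm0_eq0.

Let norm1_le_hsum (z : hsum H X) : `|z.1| <= `|z|.
Proof.
rewrite -ler_sqr ?nnegrE//.
by rewrite [leRHS]sqr_hsum_norm lerDl exprn_ge0.
Qed.

Let norm2_le_hsum (z : hsum H X) : `|z.2| <= `|z|.
Proof.
rewrite -ler_sqr ?nnegrE//.
by rewrite [leRHS]sqr_hsum_norm lerDr exprn_ge0.
Qed.

Let hsum_norm_le (z : hsum H X) : `|z| <= `|z.1| + `|z.2|.
Proof.
rewrite -ler_sqr ?nnegrE ?addr_ge0//.
by rewrite [leLHS]sqr_hsum_norm sqrrD addrAC lerDl mulrn_wge0// mulr_ge0.
Qed.

Let hsum_complete (F : set_system (hsum H X)) :
  ProperFilter F -> cauchy F -> cvg F.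
Proof.
move=> FF /cauchyP Fc.
have F1 : cvg (fst @ F : set_system H).
  apply: cauchy_cvg; apply/cauchyP => e e0.
  have [z Fz] := Fc _ e0; exists z.1.
  change (F [set w : hsum H X | ball z.1 e w.1]).
  apply: filterS Fz => w /=; rewrite -!ball_normE /=; apply: le_lt_trans.
  exact: norm1_le_hsum (z - w).
have F2 : cvg (snd @ F : set_system X).
  apply: cauchy_cvg; apply/cauchyP => e e0.
  have [z Fz] := Fc _ e0; exists z.2.
  change (F [set w : hsum H X | ball z.2 e w.2]).
  apply: filterS Fz => w /=; rewrite -!ball_normE /=; apply: le_lt_trans.
  exact: norm2_le_hsum (z - w).
have [/cvg_ex[f /cvgrPdist_lt Ff] /cvg_ex[g /cvgrPdist_lt Fg]] := (F1, F2).
apply/cvg_ex; exists ((f, g) : hsum H X).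
apply/cvgrPdist_lt => e e0; near=> z.
apply: le_lt_trans (hsum_norm_le _) _; rewrite (splitr e) ltrD//=.
  by near: z; apply: Ff; rewrite divr_gt0.
by near: z; apply: Fg; rewrite divr_gt0.
Unshelve. all: by end_near. Qed.

HB.instance Definition _ := Uniform_isComplete.Build (hsum H X) hsum_complete.

Let sqr_norm_hsum (z : hsum H X) : `|z| ^+ 2 = hsum_inner z z.
Proof. exact: sqrtCK. Qed.

HB.instance Definition _ := isHilbert.Build C (hsum H X) sqr_norm_hsum.

End DirectSum.

Definition opsum (C : numClosedFieldType) (H X Z Y : hilbertType C)
    (R : H -> Z) (R' : X -> Y) : hsum H X -> hsum Z Y :=
  fun z => (R z.1, R' z.2).

Definition setsum (C : numClosedFieldType) (H X : hilbertType C)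
    (M : set H) (N : set X) : set (hsum H X) := M `*` N.

Definition separable (T : topologicalType) : Prop :=
  exists2 D : set T, countable D & dense D.

Section Operators.
Variable C : numClosedFieldType.

Definition bounded_op (E F : hilbertType C) (T : E -> F) : Prop :=
  linear T /\ exists M : C, forall x, `|T x| <= M * `|x|.

(* By the Riesz theorem, over [R[i]] with [R : realType] the set below is a
   singleton for every [y] when [T] is bounded. *)
Definition adjoint (E F : hilbertType C) (T : E -> F) : F -> E :=
  fun y => xget 0 [set z | forall x, hinner (T x) y = hinner x z].

Definition invertible_op (E : hilbertType C) (T : E -> E) : Prop :=
  bounded_op T /\
  exists S : E -> E, [/\ bounded_op S, cancel T S & cancel S T].

Definition closed_subspace (E : hilbertType C) (M : set E) : Prop :=
  [/\ closed M, M 0 & forall (a : C) x y, M x -> M y -> M (a *: x + y)].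

(* By the projection theorem, over [R[i]] the set below is a singleton for every
   [x] when [M] is a closed
   subspace. *)
Definition orth_proj (E : hilbertType C) (M : set E) : E -> E :=
  fun x => xget 0 [set p | M p /\ forall m, M m -> hinner (x - p) m = 0].

End Operators.

Section ControlledFrames.
Variables (R : realType) (E : hilbertType R[i]) (I : choiceType).
Variables (Q Q' : E -> E) (M : I -> set E).
Variables (Z : I -> hilbertType R[i]) (Theta : forall i, E -> Z i).
Variable v : I -> R.

(* [R[i]^o] is [R[i]] seen as a normed module over itself. *)
Definition frame_form (e : E) (i : I) : R[i]^o :=
  (v i)%:C%C ^+ 2 * hinner (Theta i (orth_proj (M i) (Q' e)))
                           (Theta i (orth_proj (M i) (Q e))).

(* Sums over [I] are unconditional: they are limits of the finite partial sums
   along the directed set of finite subsets of [I]. The inequalities hold in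
   [R[i]], where [x <= y] implies that [y - x] is real. *)
Definition controlled_frame_bounds (K : E -> E) (a b : R) : Prop :=
  [/\ [/\ invertible_op Q, invertible_op Q' & bounded_op K],
      forall i, [/\ closed_subspace (M i), bounded_op (Theta i) & 0 < v i],
      0 < a, a <= b
    & forall e, cvg (partial_sum (frame_form e) @ totally) /\
        a%:C%C * `|adjoint K e| ^+ 2 <= sum (frame_form e)
          <= b%:C%C * `|e| ^+ 2].

Definition controlled_frame (K : E -> E) : Prop :=
  exists a b : R, controlled_frame_bounds K a b.

Definition frame_series (e : E) (i : I) : E :=
  (v i)%:C%C ^+ 2 *: adjoint Q (orth_proj (M i)
    (adjoint (Theta i) (Theta i (orth_proj (M i) (Q' e))))).

Definition frame_operator (e : E) : E := sum (frame_series e).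

End ControlledFrames.

(* Main.v *)
Require Import Defs.
From HB Require Import structures.
From mathcomp Require Import all_boot all_order all_algebra finmap.
From mathcomp Require Import complex sesquilinear.
From mathcomp Require Import all_classical all_reals all_analysis.
From mathcomp Require Import summability ring lra.
Set Implicit Arguments.
Unset Strict Implicit.
Unset Printing Implicit Defensive.
Import Order.TTheory GRing.Theory Num.Theory.
Import numFieldNormedType.Exports.
Local Open Scope classical_set_scope.
Local Open Scope ring_scope.
#[local] Existing Instance totally_filter.

(* For a bounded bijection w and a closed subspace M one has
   P_M w^* P_{wM} = P_M w^*, because w^* maps the orthogonal complement of wM
   into that of M. Applied to w = W (+) V, whose adjoint commutes with the
   controlling operators, this turns each term of the quadratic form and
   of the frame series of Delta at z into the corresponding term for the direct
   sum of the two given frames at w^* z, the latter followed by w. The frame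
   bounds follow since w^* is bounded and bounded below.

   The frame series converges in norm because polarization makes it converge
   weakly along finite index sets, and in a Hilbert space such a series is
   unconditionally convergent: its finite partial sums are bounded, whereas
   infinitely many disjoint blocks of norm at least d would, with suitable signs,
   add up to vectors of arbitrarily large norm. *)

(** * Real-valued norms and limits in normed modules over [R[i]] *)

Section RealNorm.
Variables (R : realType) (V : normedModType R[i]).
Implicit Types x y : V.

(* The norm of a normed module over [R[i]] takes its values in [R[i]]; this is
   the same norm with values in the ordered field [R]. *)
Definition rnorm x : R := complex.Re `|x|.

Lemma rnormE x : `|x| = (rnorm x)%:C%C.
Proof. by rewrite RRe_real// normr_real. Qed.

Lemma rnorm_ge0 x : 0 <= rnorm x.
Proof. by rewrite -ler0c -rnormE. Qed.

Lemma rnorm0 : rnorm 0 = 0.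
Proof. by rewrite /rnorm normr0. Qed.

Lemma rnorm_eq0 x : rnorm x = 0 -> x = 0.
Proof. by move=> x0; apply/eqP; rewrite -normr_eq0 rnormE x0. Qed.

Lemma ler_rnormD x y : rnorm (x + y) <= rnorm x + rnorm y.
Proof. by rewrite -lecR rmorphD /= -!rnormE ler_normD. Qed.

Lemma rnormN x : rnorm (- x) = rnorm x.
Proof. by rewrite /rnorm normrN. Qed.

Lemma rnormMn x n : rnorm (x *+ n) = rnorm x *+ n.
Proof. by apply: complexI; rewrite rmorphMn /= -!rnormE normrMn. Qed.

Lemma rdistC x y : rnorm (x - y) = rnorm (y - x).
Proof. by rewrite /rnorm distrC. Qed.

Lemma ler_rnormB x y : rnorm (x - y) <= rnorm x + rnorm y.
Proof. by rewrite -(rnormN y) ler_rnormD. Qed.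

(** A positive element of [R[i]] is real, so the tolerances in a limit may be drawn from [R]. This
    keeps the later estimates in a totally ordered field, where [lra] and [nra] apply. *)
Lemma cvg_rnormP (T : Type) (F : set_system T) {FF : Filter F} (f : T -> V) l :
  f @ F --> l <->
  forall e : R, 0 < e -> \forall t \near F, rnorm (l - f t) < e.
Proof.
rewrite (cvgrPdist_lt (F := F)); split=> [fl e e0|fl e e0].
  have := fl e%:C%C; rewrite ltcR => /(_ e0); apply: filterS => t.
  by rewrite rnormE ltcR.
have -> : e = (complex.Re e)%:C%C by rewrite RRe_real// gtr0_real.
have /fl : 0 < complex.Re e.
  by rewrite -(ltcR 0) [X in _ < X]RRe_real// gtr0_real.
by apply: filterS => t; rewrite rnormE ltcR.
Qed.

End RealNorm.

Lemma rnormZ (R : realType) (V : normedModType R[i])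
    (a : R[i]) (x : V) :
  rnorm (a *: x) = rnorm (a : R[i]^o) * rnorm x.
Proof. by apply: complexI; rewrite rmorphM /= -!rnormE normrZ. Qed.

Lemma rnorm_real (R : realType) (c : R) : 0 <= c -> rnorm (c%:C%C : R[i]^o) = c.
Proof. by move=> c0; apply: complexI; rewrite -rnormE ger0_norm ?ler0c. Qed.

(** The limit inherits the rate [e]: if [l] were farther than [e n] from [u n], a term close enough
    to [l] and of index at least [n] would contradict the triangle inequality. *)
Lemma cauchy_seq_cvg (R : realType) (V : completeNormedModType R[i])
    (u : nat -> V) (e : nat -> R) :
  (forall r : R, 0 < r -> exists n, e n < r) ->
  (forall n m, (n <= m)%N -> rnorm (u m - u n) <= e n) ->
  exists l, u @ \oo --> l /\ forall n, rnorm (l - u n) <= e n.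
Proof.
move=> e0 ue.
have : cvg (u @ \oo).
  apply: cauchy_cvg; apply: cauchy_exP => r r0.
  have rE : r = (complex.Re r)%:C%C by rewrite RRe_real// gtr0_real.
  have [n enr] : exists n, e n < complex.Re r.
    by apply: e0; rewrite -(ltcR 0) -rE.
  exists (u n); exists n => // m /= nm; rewrite -ball_normE /=.
  by rewrite rnormE rE ltcR rdistC (le_lt_trans (ue _ _ nm)).
move=> /cvg_ex[l ul]; exists l; split=> // n.
rewrite leNgt; apply/negP => lun.
have /cvg_rnormP/(_ (rnorm (l - u n) - e n)) := ul.
rewrite subr_gt0 => /(_ lun).
move=> [k _ /(_ (maxn n k))] /=; rewrite leq_maxr => /(_ isT).
have := ue n (maxn n k) (leq_maxl _ _).
have := ler_rnormD (l - u (maxn n k)) (u (maxn n k) - u n).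
rewrite addrA subrK; lra.
Qed.

(** * Inner product identities and the Cauchy-Schwarz inequality *)

Section InnerProduct.
Variables (R : realType) (E : hilbertType R[i]).
Implicit Types x y z : E.
Implicit Types a : R[i].

Lemma hinnerDl x y z : hinner (x + y) z = hinner x z + hinner y z.
Proof. exact: linearDl. Qed.

Lemma hinnerDr x y z : hinner x (y + z) = hinner x y + hinner x z.
Proof. exact: linearDr. Qed.

Lemma hinnerNl x y : hinner (- x) y = - hinner x y.
Proof. exact: linearNl. Qed.

Lemma hinnerNr x y : hinner x (- y) = - hinner x y.
Proof. exact: linearNr. Qed.

Lemma hinnerBl x y z : hinner (x - y) z = hinner x z - hinner y z.
Proof. exact: linearBl. Qed.

Lemma hinnerZl a x y : hinner (a *: x) y = a * hinner x y.
Proof. exact: linearZl_LR. Qed.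

Lemma hinnerZr a x y : hinner x (a *: y) = Num.conj a * hinner x y.
Proof. exact: linearZr_LR. Qed.

Lemma hinner0l x : hinner 0 x = 0.
Proof. exact: linear0l. Qed.

Lemma hinner0r x : hinner x 0 = 0.
Proof. exact: linear0r. Qed.

Lemma hinnerC x y : hinner x y = Num.conj (hinner y x).
Proof. by rewrite [LHS]hermC expr0 mul1r. Qed.

Lemma hinner_rnorm x : hinner x x = (rnorm x ^+ 2)%:C%C.
Proof. by rewrite -sqr_norm_hinner rnormE rmorphXn. Qed.

Lemma hinner_ext x y : (forall z, hinner x z = hinner y z) -> x = y.
Proof.
move=> xy; apply/eqP; rewrite -subr_eq0 -(dnorm_eq0 (@hinner _ E)).
by rewrite hinnerBl xy subrr.
Qed.

Lemma hinner_extr x y : (forall z, hinner z x = hinner z y) -> x = y.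
Proof.
by move=> xy; apply: hinner_ext => z; rewrite hinnerC xy -hinnerC.
Qed.

Lemma rnorm_conj a : rnorm (Num.conj a : R[i]^o) = rnorm (a : R[i]^o).
Proof. by rewrite /rnorm norm_conjC. Qed.

Lemma rnorm_hinnerC x y :
  rnorm (hinner x y : R[i]^o) = rnorm (hinner y x : R[i]^o).
Proof. by rewrite hinnerC rnorm_conj. Qed.

Lemma parallelogram x y :
  rnorm (x + y) ^+ 2 + rnorm (x - y) ^+ 2
  = 2 * rnorm x ^+ 2 + 2 * rnorm y ^+ 2.
Proof.
apply: complexI; rewrite !mulr_natl !mulr2n !rmorphD /= -!hinner_rnorm.
rewrite !(hinnerDl, hinnerDr, hinnerNl, hinnerNr).
ring.
Qed.

Lemma sqr_rnormBZ a x y :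
  (rnorm (x - a *: y) ^+ 2)%:C%C = (rnorm x ^+ 2)%:C%C
  - Num.conj a * hinner x y - a * Num.conj (hinner x y)
  + a * Num.conj a * (rnorm y ^+ 2)%:C%C.
Proof.
rewrite -!hinner_rnorm !(hinnerDl, hinnerDr, hinnerNl, hinnerNr).
rewrite !(hinnerZl, hinnerZr, hinnerNl, hinnerNr) -hinnerC.
ring.
Qed.

(* The left-hand side is minimal in [a] at [a = <x, y> / |y|^2]. *)
Lemma sqr_rnormB_proj x y :
  rnorm y ^+ 2 * rnorm (x - (hinner x y / (rnorm y ^+ 2)%:C%C) *: y) ^+ 2
  = rnorm y ^+ 2 * rnorm x ^+ 2 - rnorm (hinner x y : R[i]^o) ^+ 2.
Proof.
have [y0|y0] := eqVneq (rnorm y) 0.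
  by rewrite y0 (rnorm_eq0 y0) hinner0r rnorm0 expr0n /= !mul0r subr0.
apply: complexI; rewrite [RHS]rmorphB [LHS]rmorphM [in RHS]rmorphM /=.
rewrite sqr_rnormBZ [X in _ = _ - X]rmorphXn /= -rnormE normCK.
set s := (rnorm y ^+ 2)%:C%C; set c := hinner x y.
have s0 : s != 0 by rewrite /s (inj_eq (@complexI R) _ 0) expf_neq0.
have -> : Num.conj (c / s) = Num.conj c / s.
  by rewrite rmorphM fmorphV /= [Num.conj s]conj_Creal// complex_real.
by clearbody s c; field; exact: s0.
Qed.

(** The left-hand side of [sqr_rnormB_proj] is nonnegative. *)
Lemma cauchy_schwarz x y :
  rnorm (hinner x y : R[i]^o) <= rnorm x * rnorm y.
Proof.
rewrite -ler_sqr ?nnegrE ?mulr_ge0 ?rnorm_ge0// exprMn mulrC -subr_ge0.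
by rewrite -sqr_rnormB_proj mulr_ge0// sqr_ge0.
Qed.

End InnerProduct.

(** * Orthogonal projections onto closed subspaces *)

Section Projection.
Variables (R : realType) (E : hilbertType R[i]).
Implicit Types (x y : E) (M : set E).

Lemma closed_subspace0 M : closed_subspace M -> M 0.
Proof. by case. Qed.

Lemma closed_subspaceP M (a : R[i]) x y :
  closed_subspace M -> M x -> M y -> M (a *: x + y).
Proof. by case=> _ _; apply. Qed.

Lemma closed_subspaceD M x y : closed_subspace M -> M x -> M y -> M (x + y).
Proof. by move=> cM Mx My; rewrite -(scale1r x); exact: closed_subspaceP. Qed.

Lemma closed_subspaceZ M (a : R[i]) x : closed_subspace M -> M x -> M (a *: x).
Proof.
move=> cM Mx; rewrite -(addr0 (a *: x)); apply: closed_subspaceP => //.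
exact: closed_subspace0.
Qed.

Lemma closed_subspaceB M x y : closed_subspace M -> M x -> M y -> M (x - y).
Proof.
by move=> cM Mx My; rewrite addrC -scaleN1r; exact: closed_subspaceP.
Qed.

Lemma eq0_small_sqr (a c : R) :
  (forall n, a ^+ 2 <= c / n.+1%:R) -> a = 0.
Proof.
move=> ac; apply/eqP; rewrite -sqrf_eq0 eq_le sqr_ge0 andbT leNgt.
apply/negP => a0; have c0 : 0 < c.
  by have := lt_le_trans a0 (ac 0%N); rewrite divr1.
have := ac (Num.truncn (c / a ^+ 2)); apply/negP; rewrite -ltNge.
by rewrite ltr_pdivrMr// mulrC -ltr_pdivrMr// truncnS_gt.
Qed.

(** A minimizing sequence [u] for the distance from [x] to [M] is Cauchy by the parallelogram law.
    Orthogonality of [x - p] is read off from the near-minimality of the [u n], with errors of order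
    [1 / n.+1]. *)
Lemma projection_exists M x : closed_subspace M ->
  exists p, M p /\ forall m, M m -> hinner (x - p) m = 0.
Proof.
move=> cM; pose A := [set rnorm (x - m) ^+ 2 | m in M].
have infA : has_inf A.
  split.
    by exists (rnorm (x - 0) ^+ 2); exists 0 => //; exact: closed_subspace0.
  by exists 0 => _ [m _ <-]; exact: sqr_ge0.
pose d := inf A.
have dA m : M m -> d <= rnorm (x - m) ^+ 2.
  by move=> Mm; apply: ge_inf; [exact: infA.2|exists m].
have /choice[u uP] (n : nat) :
    exists m, M m /\ rnorm (x - m) ^+ 2 < d + n.+1%:R^-1.
  have [|_ [m Mm <-] lt] := @inf_adherent _ A n.+1%:R^-1 _ infA.
    by rewrite invr_gt0.
  by exists m.
have u_cauchy n m : (n <= m)%N -> rnorm (u m - u n) ^+ 2 <= 4 / n.+1%:R.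
  move=> nm.
  have := parallelogram (x - u n) (x - u m).
  have -> : x - u n - (x - u m) = u m - u n.
    by rewrite opprB addrC addrA subrK.
  (* The midpoint of [u n] and [u m] lies in [M], so its squared distance to [x] is at least [d];
     the parallelogram law then leaves at most [2 / n.+1 + 2 / m.+1]. *)
  have -> : x - u n + (x - u m) = (x - 2^-1 *: (u n + u m)) *+ 2.
    rewrite mulrnBl -[(_ *: _) *+ 2]scaler_nat scalerA divff ?pnatr_eq0//.
    by rewrite scale1r mulr2n opprD addrACA.
  rewrite rnormMn exprMn_n.
  have := dA (2^-1 *: (u n + u m)).
  have [Mun un] := uP n; have [Mum um] := uP m.
  move=> /(_ (closed_subspaceZ _ cM (closed_subspaceD cM Mun Mum))).
  have : m.+1%:R^-1 <= n.+1%:R^-1 :> R by rewrite lef_pV2 ?posrE// ler_nat.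
  move: un um; move: (rnorm (x - u n) ^+ 2) (rnorm (x - u m) ^+ 2) => a b.
  move: (rnorm (x - _) ^+ 2) (rnorm (u m - u n) ^+ 2) => c e.
  move: (n.+1%:R^-1) (m.+1%:R^-1) => s t; rewrite -mulr_natl; lra.
have [r r0|n m nm|p [up pu]] := @cauchy_seq_cvg R E u
    (fun n => Num.sqrt (4 / n.+1%:R)).
- exists (Num.truncn (4 / r ^+ 2)).
  rewrite -[ltRHS](@ger0_norm _ r) ?ltW// -sqrtr_sqr ltr_sqrt ?exprn_gt0//.
  by rewrite ltr_pdivrMr// mulrC -ltr_pdivrMr ?exprn_gt0// truncnS_gt.
- rewrite -[leLHS](@ger0_norm _ _) ?rnorm_ge0//.
  by rewrite -sqrtr_sqr ler_wsqrtr// u_cauchy.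
have Mp : M p.
  have [clM _ _] := cM.
  by apply: (closed_cvg M clM _ _ up); apply: nearW => n; case: (uP n).
exists p; split=> // m Mm.
apply: (@rnorm_eq0 R R[i]^o).
(* Splitting [x - p] at [u n] gives two inner products whose squares are at most 1 and 4 times
   [|m|^2 / n.+1]; since [(a + b)^2 <= 2 a^2 + 2 b^2], the total constant is 10. *)
apply: (@eq0_small_sqr _ (10 * rnorm m ^+ 2)) => n.
have [Mun un] := uP n.
(* Moving from [u n] by the optimal multiple [t] of [m] stays in [M], so it can lower the squared
   distance by at most [1 / n.+1]; by [sqr_rnormB_proj] this drop times [|m|^2] is the left-hand
   side. *)
have h1 : rnorm (hinner (x - u n) m : R[i]^o) ^+ 2 <= rnorm m ^+ 2 / n.+1%:R.
  have := sqr_rnormB_proj (x - u n) m; set t := _ / _.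
  have := dA (u n + t *: m)
    (closed_subspaceD cM Mun (closed_subspaceZ _ cM Mm)).
  rewrite opprD addrA => dt qt.
  have -> : rnorm (hinner (x - u n) m : R[i]^o) ^+ 2 =
      rnorm m ^+ 2 * (rnorm (x - u n) ^+ 2 - rnorm (x - u n - t *: m) ^+ 2).
    by rewrite mulrBr qt opprB addrCA subrr addr0.
  by rewrite ler_wpM2l ?sqr_ge0// lerBlDl (le_trans (ltW un))// lerD2r.
have h2 : rnorm (hinner (u n - p) m : R[i]^o) ^+ 2
    <= 4 / n.+1%:R * rnorm m ^+ 2.
  apply: (@le_trans _ _ ((rnorm (p - u n) * rnorm m) ^+ 2)).
    rewrite ler_sqr ?nnegrE ?mulr_ge0 ?rnorm_ge0// rdistC.
    exact: cauchy_schwarz.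
  rewrite exprMn ler_wpM2r ?sqr_ge0//.
  rewrite -[4 / _]sqr_sqrtr ?divr_ge0//.
  by rewrite ler_sqr ?nnegrE ?rnorm_ge0 ?sqrtr_ge0//; exact: pu.
have -> : x - p = (x - u n) + (u n - p) by rewrite addrA subrK.
rewrite hinnerDl.
have := ler_rnormD (hinner (x - u n) m : R[i]^o) (hinner (u n - p) m).
have := @rnorm_ge0 R R[i]^o (hinner (x - u n) m + hinner (u n - p) m).
move: h1 h2; set a := rnorm (hinner (x - u n) m : R[i]^o).
set b := rnorm (hinner (u n - p) m : R[i]^o).
clearbody a b; move=> h1 h2 c0 cab; apply: (@le_trans _ _ ((a + b) ^+ 2)).
  by rewrite ler_sqr ?nnegrE// (le_trans c0).
move: h1 h2 (sqr_ge0 (a - b)); move: (rnorm m ^+ 2) n.+1%:R^-1 => q s.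
rewrite !expr2; nra.
Qed.

Lemma orth_projP M x : closed_subspace M ->
  M (orth_proj M x) /\ forall m, M m -> hinner (x - orth_proj M x) m = 0.
Proof. by move=> /(projection_exists x)/(xgetPex 0). Qed.

Lemma orth_proj_unique M x p : closed_subspace M -> M p ->
  (forall m, M m -> hinner (x - p) m = 0) -> orth_proj M x = p.
Proof.
move=> cM Mp xp; have [MP xP] := orth_projP x cM.
have MB : M (orth_proj M x - p) by exact: closed_subspaceB.
apply/eqP; rewrite -subr_eq0 -(dnorm_eq0 (@hinner _ E)).
rewrite -{1}(subrKA x) -(opprB x) hinnerDl hinnerNl xp// xP//.
by rewrite oppr0 addr0.
Qed.

(** Both sides equal the inner product of the two projections. *)
Lemma orth_proj_adj M x y : closed_subspace M ->
  hinner (orth_proj M x) y = hinner x (orth_proj M y).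
Proof.
move=> cM; have [Mx xP] := orth_projP x cM; have [My yP] := orth_projP y cM.
have := xP _ My; rewrite hinnerBl => /subr0_eq ->.
have := yP _ Mx; rewrite hinnerBl => /subr0_eq h.
by rewrite hinnerC h -hinnerC.
Qed.

Lemma orth_proj_id M x : closed_subspace M -> M x -> orth_proj M x = x.
Proof.
by move=> cM Mx; apply: orth_proj_unique => // m _; rewrite subrr hinner0l.
Qed.

Lemma orth_proj_linear M : closed_subspace M -> linear (orth_proj M).
Proof.
move=> cM a x y; apply: hinner_ext => z.
by rewrite hinnerDl hinnerZl !orth_proj_adj// hinnerDl hinnerZl.
Qed.

(** Self-adjointness and idempotence give [|Px|^2 = <Px, x>], and Cauchy-Schwarz allows division by
    [|Px|]. *)
Lemma ler_rnorm_orth_proj M x : closed_subspace M ->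
  rnorm (orth_proj M x) <= rnorm x.
Proof.
move=> cM; have [Mx _] := orth_projP x cM.
have [->|P0] := eqVneq (rnorm (orth_proj M x)) 0; first exact: rnorm_ge0.
have : 0 < rnorm (orth_proj M x) by rewrite lt_neqAle eq_sym P0 rnorm_ge0.
move=> P1; rewrite -(ler_pM2l P1) -expr2.
have := cauchy_schwarz (orth_proj M x) x; rewrite mulrC.
rewrite -{1}(orth_proj_id cM Mx) orth_proj_adj// hinner_rnorm.
by apply: le_trans; rewrite rnorm_real ?sqr_ge0.
Qed.

Lemma bounded_orth_proj M : closed_subspace M -> bounded_op (orth_proj M).
Proof.
move=> cM; split; first exact: orth_proj_linear.
by exists 1 => x; rewrite mul1r !rnormE lecR ler_rnorm_orth_proj.
Qed.

End Projection.

(** * Linear maps given as plain functions, and their continuity *)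

Section LinearMaps.
Variables (R : realType) (V W : lmodType R[i]) (f : V -> W).
Hypothesis lf : linear f.

Lemma linear_mapD x y : f (x + y) = f x + f y.
Proof. by rewrite -{1}(scale1r x) lf scale1r. Qed.

Lemma linear_map0 : f 0 = 0.
Proof. by have := lf (-1) 0 0; rewrite scaler0 addr0 scaleN1r addNr. Qed.

Lemma linear_mapZ a x : f (a *: x) = a *: f x.
Proof. by rewrite -[X in f X]addr0 lf linear_map0 addr0. Qed.

Lemma linear_mapN x : f (- x) = - f x.
Proof. by rewrite -scaleN1r linear_mapZ scaleN1r. Qed.

Lemma linear_mapB x y : f (x - y) = f x - f y.
Proof. by rewrite linear_mapD linear_mapN. Qed.

End LinearMaps.

Lemma rbounded_continuous (R : realType) (V W : normedModType R[i])
    (f : V -> W) (c : R) : linear f ->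
  (forall x, rnorm (f x) <= c * rnorm x) -> continuous f.
Proof.
move=> lf fc x; apply/cvg_rnormP => e e0.
(* [c] may be zero or negative, so [|c| + 1] serves as a positive Lipschitz constant. *)
have c1 : 0 < `|c| + 1 by rewrite ltr_wpDl.
have /cvg_rnormP/(_ (e / (`|c| + 1))) : id y @[y --> x] --> x by exact: cvg_id.
rewrite divr_gt0// => /(_ isT); apply: filterS => y.
rewrite ltr_pdivlMr// => lt; rewrite -linear_mapB//.
apply: le_lt_trans lt; apply: le_trans (fc _) _.
by rewrite mulrC ler_wpM2l ?rnorm_ge0// (le_trans (ler_norm _))// lerDl.
Qed.

(** * Bounded operators, Riesz representation and adjoints *)

Section BoundedOperators.
Variable R : realType.
Implicit Types E F G : hilbertType R[i].

Lemma bounded_opP E F (T : E -> F) :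
  bounded_op T <->
  linear T /\ exists2 c : R, 0 <= c & forall x, rnorm (T x) <= c * rnorm x.
Proof.
split=> [[lT [c Tc]]|[lT [c c0 Tc]]]; split=> //.
  (* Here [c] is complex. The product of [c] with the norm of [x] bounds a norm, so it is real and
     nonnegative and equals its own modulus. *)
  exists (rnorm (c : R[i]^o)); first exact: rnorm_ge0.
  move=> x; have cx := le_trans (normr_ge0 _) (Tc x).
  rewrite -lecR rmorphM /= -!rnormE -[X in _ * X]normr_id -normrM.
  by rewrite (ger0_norm cx).
by exists c%:C%C => x; rewrite !rnormE -rmorphM lecR.
Qed.

Lemma bounded_op_linear E F (T : E -> F) : bounded_op T -> linear T.
Proof. by case. Qed.

Lemma bounded_op_continuous E F (T : E -> F) : bounded_op T -> continuous T.
Proof. by move=> /bounded_opP[lT [c _]]; exact: rbounded_continuous. Qed.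

Lemma bounded_op_comp E F G (T : F -> G) (S : E -> F) :
  bounded_op T -> bounded_op S -> bounded_op (T \o S).
Proof.
move=> /bounded_opP[lT [c c0 Tc]] /bounded_opP[lS [d d0 Sd]].
apply/bounded_opP; split=> [a x y|] /=; first by rewrite lS lT.
exists (c * d) => [|x /=]; first exact: mulr_ge0.
by rewrite -mulrA (le_trans (Tc _))// ler_wpM2l.
Qed.

(** If [phi] is nonzero, the component [z] of some vector orthogonal to the kernel has [phi z != 0],
    and every [x] differs from a multiple of [z] by an element of the kernel. *)
Lemma riesz E (phi : E -> R[i]^o) (c : R) : linear phi ->
  (forall x, rnorm (phi x) <= c * rnorm x) ->
  exists y, forall x, phi x = hinner x y.
Proof.
move=> lphi phic; pose N := phi @^-1` [set 0].
have [phi0|/existsNP[x0 /eqP x0N]] := pselect (forall x, phi x = 0).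
  by exists 0 => x; rewrite hinner0r.
have cN : closed_subspace N.
  split=> [||a x y Nx Ny]; last 2 first.
  - by rewrite /N /=; exact: linear_map0.
  - by rewrite /N /= in Nx Ny *; rewrite lphi Nx Ny scaler0 addr0.
  apply: closed_comp => [x _|]; first exact: rbounded_continuous phic x.
  apply: accessible_closed_set1; apply: hausdorff_accessible.
  exact: norm_hausdorff.
pose z := x0 - orth_proj N x0; have [NP zP] := orth_projP x0 cN.
have phiz : phi z != 0 by rewrite linear_mapB// [phi (orth_proj _ _)]NP subr0.
have z0 : hinner z z != 0.
  rewrite dnorm_eq0; apply: contra_neq phiz => ->; exact: linear_map0.
(* The coefficient is conjugated because [hinner] is conjugate-linear in its second argument. *)
exists (Num.conj (phi z / hinner z z) *: z) => x.
rewrite hinnerZr conjCK.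
have /zP : N (x - (phi x / phi z) *: z).
  rewrite /N /= linear_mapB// linear_mapZ//.
  by rewrite /GRing.scale /= divfK// subrr.
rewrite -/z hinnerC hinnerBl hinnerZl => /eqP.
rewrite conjC_eq0 subr_eq0 => /eqP ->.
by field; rewrite phiz z0.
Qed.

(** Riesz representation of [x |-> <T x, y>] shows that the set from which [adjoint] chooses is
    nonempty, so the default value 0 of [xget] is not what is returned by accident. *)
Lemma adjointP E F (T : E -> F) (x : E) (y : F) : bounded_op T ->
  hinner (T x) y = hinner x (adjoint T y).
Proof.
move=> /bounded_opP[lT [c c0 Tc]].
have [|u|z zP] := @riesz E (fun x => hinner (T x) y) (c * rnorm y).
- by move=> a u v; rewrite lT hinnerDl hinnerZl.
- rewrite (le_trans (cauchy_schwarz _ _))// mulrAC ler_wpM2r ?rnorm_ge0//.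
suff : [set z | forall x, hinner (T x) y = hinner x z] (adjoint T y) by apply.
by apply: xgetPex; exists z.
Qed.

Lemma adjointPr E F (T : E -> F) (x : E) (y : F) : bounded_op T ->
  hinner y (T x) = hinner (adjoint T y) x.
Proof. by move=> bT; rewrite hinnerC adjointP// -hinnerC. Qed.

Lemma adjoint_unique E F (T : E -> F) (S : F -> E) : bounded_op T ->
  (forall x y, hinner (T x) y = hinner x (S y)) -> adjoint T = S.
Proof.
move=> bT TS; apply/funext => y; apply: hinner_extr => x.
by rewrite -adjointP.
Qed.

(** With [z = adjoint T y], one has [|z|^2 = <T z, y> <= c |z| |y|], so the adjoint has the same
    bound as [T]. *)
Lemma bounded_adjoint E F (T : E -> F) : bounded_op T -> bounded_op (adjoint T).
Proof.
move=> bT; have /bounded_opP[lT [c c0 Tc]] := bT; apply/bounded_opP; split.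
  move=> a x y; apply: hinner_ext => z.
  by rewrite hinnerDl hinnerZl -!adjointPr// hinnerDl hinnerZl.
exists c => // y; set z := adjoint T y.
have [->|z0] := eqVneq (rnorm z) 0; first by rewrite mulr_ge0 ?rnorm_ge0.
have zgt0 : 0 < rnorm z by rewrite lt_neqAle eq_sym z0 rnorm_ge0.
rewrite -(ler_pM2l zgt0) -expr2 -[leLHS]rnorm_real ?sqr_ge0// -hinner_rnorm.
rewrite {2}/z -adjointP// (le_trans (cauchy_schwarz _ _))//.
by rewrite mulrA [rnorm z * c]mulrC ler_wpM2r ?rnorm_ge0.
Qed.

Lemma adjointK E F (T : E -> F) : bounded_op T -> adjoint (adjoint T) = T.
Proof.
move=> bT; apply: adjoint_unique => [|x y]; first exact: bounded_adjoint.
by rewrite adjointPr.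
Qed.

Lemma adjoint_comp E F G (T : F -> G) (S : E -> F) :
  bounded_op T -> bounded_op S -> adjoint (T \o S) = adjoint S \o adjoint T.
Proof.
move=> bT bS; apply: adjoint_unique => [|x y]; first exact: bounded_op_comp.
by rewrite /= !adjointP.
Qed.

End BoundedOperators.

(** * Weakly bounded sets are norm bounded *)

Section UniformBoundedness.
Variables (R : realType) (E : hilbertType R[i]).

(** The pairings of [a + b] and [a - b] with [y] differ by [2 <b, y>], so they cannot both be
    smaller than [<b, y>] in modulus. *)
Let sign_step (a b y : E) :
  let c := if rnorm (hinner b y : R[i]^o) <= rnorm (hinner (a + b) y : R[i]^o)
           then a + b else a - b in
  rnorm (hinner b y : R[i]^o) <= rnorm (hinner c y : R[i]^o)
  /\ rnorm (c - a) = rnorm b.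
Proof.
case: ifPn => [le|]; first by split=> //; rewrite addrAC subrr add0r.
rewrite -ltNge => lt; split; last by rewrite addrAC subrr add0r rnormN.
have := ler_rnormB (hinner (a + b) y : R[i]^o) (hinner (a - b) y).
have -> : hinner (a + b) y - hinner (a - b) y = hinner b y + hinner b y.
  by rewrite hinnerBl hinnerDl; ring.
have -> : rnorm (hinner b y + hinner b y : R[i]^o)
    = 2 * rnorm (hinner b y : R[i]^o).
  by rewrite -mulr2n rnormMn mulr_natl.
lra.
Qed.

(* Sokal's elementary proof of the uniform boundedness theorem: the point at
   which boundedness fails is the sum of a geometric series whose signs are
   chosen one after the other, so that no term cancels the earlier ones. *)
Lemma uniform_boundedness (S : set E) :
  (forall x, exists c : R, forall y, S y -> rnorm (hinner x y : R[i]^o) <= c) ->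
  exists2 c : R, 0 <= c & forall y, S y -> rnorm y <= c.
Proof.
move=> Sx; apply: contrapT => Sunb.
(* This size makes half of [r n.+1 * |y n|], the part that survives the tail of the series, at least
   [n]. *)
have /choice[y yP] (n : nat) : exists y, S y /\ 2 * n%:R * 3 ^+ n.+1 < rnorm y.
  apply: contrapT => Sn; apply: Sunb; exists (2 * n%:R * 3 ^+ n.+1).
    by rewrite !mulr_ge0// exprn_ge0.
  by move=> y Sy; rewrite leNgt; apply/negP => yn; apply: Sn; exists y.
pose r n : R := 3 ^- n.
have r0 n : 0 < r n by rewrite invr_gt0 exprn_gt0.
have rS n : r n = 3 * r n.+1.
  by rewrite /r exprS invfM mulrA divff ?pnatr_eq0// mul1r.
pose b n : E := (r n.+1 / rnorm (y n))%:C%C *: y n.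
have y0 n : 0 < rnorm (y n).
  by apply: le_lt_trans (yP n).2; rewrite !mulr_ge0// exprn_ge0.
have bE n : rnorm (b n) = r n.+1.
  by rewrite rnormZ rnorm_real ?divr_ge0 ?ltW// divfK// gt_eqF.
have byE n : rnorm (hinner (b n) (y n) : R[i]^o) = r n.+1 * rnorm (y n).
  rewrite hinnerZl hinner_rnorm -rmorphM rnorm_real.
    by rewrite expr2 mulrA divfK ?gt_eqF.
  by rewrite mulr_ge0 ?sqr_ge0// divr_ge0 ?ltW.
pose fix x n := if n is m.+1 then
  if rnorm (hinner (b m) (y m) : R[i]^o)
       <= rnorm (hinner (x m + b m) (y m) : R[i]^o)
  then x m + b m else x m - b m else 0.
have xb n : r n.+1 * rnorm (y n) <= rnorm (hinner (x n.+1) (y n) : R[i]^o).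
  by rewrite -byE; exact: (sign_step _ _ _).1.
have xS n : rnorm (x n.+1 - x n) = r n.+1.
  by rewrite -bE; exact: (sign_step _ _ _).2.
(* The geometric tail telescopes: [r n = 3 * r n.+1] gives [r n.+1 = r n / 2 - r n.+1 / 2]. *)
have xC n m : (n <= m)%N -> rnorm (x m - x n) <= r n / 2 - r m / 2.
  move=> /subnKC <-; elim: (m - n)%N => [|k IH].
    by rewrite addn0 !subrr rnorm0.
  rewrite addnS.
  have := ler_rnormD (x (n + k).+1 - x (n + k)%N) (x (n + k)%N - x n).
  rewrite addrA subrK xS => /le_trans; apply.
  by have := rS (n + k)%N; lra.
have [e e0|n m nm|l [_ lx]] := @cauchy_seq_cvg R E x (fun n => r n / 2).
- exists (Num.truncn e^-1).+1; rewrite ltr_pdivrMr//.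
  set n := (Num.truncn e^-1).+1.
  apply: (@lt_le_trans _ _ e); last by lra.
  rewrite /r invf_plt ?posrE ?exprn_gt0//.
  apply: (@lt_le_trans _ _ n%:R); first exact: truncnS_gt.
  by rewrite -natrX ler_nat ltnW// ltn_expl.
- by apply: le_trans (xC _ _ nm) _; rewrite gerBl divr_ge0 ?ltW.
have [c lc] := Sx l.
(* For this [n] the pairing of [l] with [y n] is at least [r n.+1 * |y n|] minus half of itself,
   hence at least [n], which exceeds the supposed bound [c]. *)
pose n := (Num.truncn `|c|).+1.
have cn : c < n%:R by rewrite (le_lt_trans (ler_norm c))// truncnS_gt.
have := lc _ (yP n).1; apply/negP; rewrite -ltNge; apply: lt_le_trans cn _.
have ly : rnorm (l - x n.+1) * rnorm (y n) <= r n.+1 / 2 * rnorm (y n).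
  by rewrite ler_pM2r// lx.
have ny : n%:R <= r n.+1 / 2 * rnorm (y n).
  have := ltW (yP n).2; rewrite -(ler_pM2l (r0 n.+1)) mulrCA mulVf ?mulr1.
    lra.
  by rewrite expf_neq0.
have := ler_rnormD (hinner (x n.+1 - l) (y n) : R[i]^o) (hinner l (y n)).
rewrite -hinnerDl subrK.
have := cauchy_schwarz (x n.+1 - l) (y n); rewrite [X in _ <= X * _]rdistC.
have := xb n; lra.
Qed.

End UniformBoundedness.

(** * Operators bounded below and the bounded inverse theorem *)

Section BoundedBelow.
Variable R : realType.
Implicit Types E F : hilbertType R[i].

(** For closedness, approximate a point of the closure by [T (u n)]; the lower bound makes [u]
    Cauchy, and its limit lies in [M] and is sent to that point by continuity. *)
Lemma closed_subspace_image E F (T : E -> F) (c : R) (M : set E) :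
  bounded_op T -> (forall x, rnorm x <= c * rnorm (T x)) ->
  closed_subspace M -> closed_subspace (T @` M).
Proof.
move=> bT Tc cM; have lT := bounded_op_linear bT; split; last 2 first.
- by exists 0; [exact: closed_subspace0|exact: linear_map0].
- move=> a _ _ [x Mx <-] [y My <-]; exists (a *: x + y); last exact: lT.
  exact: closed_subspaceP.
move=> p clp.
have /choice[u uP] (n : nat) : exists x, M x /\ rnorm (p - T x) < n.+1%:R^-1.
  have n0 : 0 < (n.+1%:R^-1 : R)%:C%C by rewrite ltcR invr_gt0.
  have [_ [[x Mx <-]]] := clp _ (nbhsx_ballx p _ n0).
  by rewrite -ball_normE /= rnormE ltcR => px; exists x.
(* For [n <= m] the images of [u n] and [u m] are within [2 / n.+1] of each other; [|c|] replaces
   [c], whose sign is free. *)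
have [r r0|n m nm|x [ux _]] := @cauchy_seq_cvg R E u
    (fun n => 2 * `|c| / n.+1%:R).
- exists (Num.truncn (r^-1 * (2 * `|c|))).
  by rewrite ltr_pdivrMr// -ltr_pdivrMl// truncnS_gt.
- apply: le_trans (Tc _) _; rewrite linear_mapB//.
  have [_ un] := uP n; have [_ um] := uP m.
  have mn : m.+1%:R^-1 <= n.+1%:R^-1 :> R by rewrite lef_pV2 ?posrE// ler_nat.
  have := ler_rnormD (T (u m) - p) (p - T (u n)).
  rewrite addrA subrK [rnorm (T (u m) - p)]rdistC => tri.
  apply: (@le_trans _ _ (`|c| * rnorm (T (u m) - T (u n)))).
    by rewrite ler_wpM2r ?rnorm_ge0// ler_norm.
  rewrite [2 * _]mulrC -mulrA ler_wpM2l//; move: un um mn tri.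
  by move: n.+1%:R^-1 m.+1%:R^-1 => s t; lra.
have Mx : M x.
  have [clM _ _] := cM.
  by apply: (closed_cvg M clM _ _ ux); apply: nearW => n; case: (uP n).
exists x => //; apply/esym/eqP; rewrite -subr_eq0; apply/eqP/rnorm_eq0/eqP.
rewrite eq_le rnorm_ge0 andbT leNgt; apply/negP => px.
have /cvg_rnormP/(_ (rnorm (p - T x) / 2)) :
    T (u n) @[n --> \oo] --> T x.
  by apply: continuous_cvg => //; exact: bounded_op_continuous.
rewrite divr_gt0// => /(_ isT)[k _ kP].
pose n := maxn k (Num.truncn (rnorm (p - T x) / 2)^-1).
have := kP n (leq_maxl _ _); have [_ un] := uP n.
have nx : n.+1%:R^-1 <= rnorm (p - T x) / 2.
  rewrite invf_ple ?posrE ?divr_gt0//; apply/ltW.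
  by rewrite (lt_le_trans (truncnS_gt _))// ler_nat ltnS leq_maxr.
have := ler_rnormD (p - T (u n)) (T (u n) - T x).
rewrite addrA subrK [rnorm (T (u n) - T x)]rdistC /=.
by move: un nx; move: n.+1%:R^-1 => s; lra.
Qed.

(** The set of [y] with [|adjoint T y| <= 1] is weakly bounded: writing a test vector as [T u], its
    pairing with [y] is at most [|u|]. Uniform boundedness and rescaling give the estimate. *)
Lemma surjective_adjoint_bounded_below E F (T : E -> F) :
  bounded_op T -> (forall y, exists x, T x = y) ->
  exists2 c : R, 0 <= c & forall y, rnorm y <= c * rnorm (adjoint T y).
Proof.
move=> bT sT; have lA := bounded_op_linear (bounded_adjoint bT).
pose S := [set y | rnorm (adjoint T y) <= 1].
have [x|c c0 cS] := @uniform_boundedness R F S.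
  have [u <-] := sT x; exists (rnorm u) => y Sy.
  rewrite adjointP// (le_trans (cauchy_schwarz _ _))//.
  by rewrite ler_piMr ?rnorm_ge0.
exists c => // y; have [Ty0|Ty0] := eqVneq (rnorm (adjoint T y)) 0.
  (* Rescaling fails here; instead [y] is orthogonal to the range of [T], which is everything, so
     [y = 0]. *)
  have [u uy] := sT y; rewrite Ty0 mulr0 le_eqVlt; apply/orP; left; apply/eqP.
  suff -> : y = 0 by exact: rnorm0.
  apply/eqP; rewrite -(dnorm_eq0 (@hinner _ F)) -{1}uy adjointP//.
  by rewrite (rnorm_eq0 Ty0) hinner0r.
have Tgt0 : 0 < rnorm (adjoint T y) by rewrite lt_neqAle eq_sym Ty0 rnorm_ge0.
have := cS ((rnorm (adjoint T y))^-1%:C%C *: y).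
rewrite /S /= linear_mapZ// !rnormZ rnorm_real ?invr_ge0 ?(ltW Tgt0)//.
by rewrite mulVf// lexx mulrC ler_pdivrMr// => /(_ isT).
Qed.

(* Bounded inverse theorem. It is applied to [T] and then to [adjoint T], whose
   range is closed because it is bounded below and dense because [T] is
   injective. *)
Lemma bijective_bounded_below E F (T : E -> F) : bounded_op T -> bijective T ->
  (exists2 c : R, 0 <= c & forall y, rnorm y <= c * rnorm (adjoint T y)) /\
  (exists2 c : R, 0 <= c & forall x, rnorm x <= c * rnorm (T x)).
Proof.
move=> bT [S TS ST]; have lT := bounded_op_linear bT.
have [|c c0 cA] := surjective_adjoint_bounded_below bT.
  by move=> y; exists (S y).
split; first by exists c.
have bA := bounded_adjoint bT.
rewrite -(adjointK bT); apply: surjective_adjoint_bounded_below => // x.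
have cT : closed_subspace [set: F].
  by split=> //; exact: closedT.
have cM := closed_subspace_image bA cA cT.
have [[y _ yP] xP] := orth_projP x cM.
(* The difference between [x] and its projection is orthogonal to the range of [adjoint T], so [T]
   kills it, and [T] is injective. *)
exists y; rewrite yP; apply/esym/eqP; rewrite -subr_eq0; apply/eqP.
apply: (can_inj TS); rewrite (linear_map0 lT); apply: hinner_ext => z.
by rewrite adjointP// hinner0l xP//; exists z.
Qed.

End BoundedBelow.

(** * Unconditional sums over finite subsets *)

Section UnconditionalSums.
Variables (R : realType) (I : choiceType).

Lemma partial_sumE (V : zmodType) (x : I -> V) (A : {fset I}) :
  partial_sum x A = \sum_(i <- A) x i.
Proof. by rewrite big_seq_fsetE. Qed.

Lemma partial_sumU (V : zmodType) (x : I -> V) (A B : {fset I}) :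
  [disjoint A & B]%fset ->
  partial_sum x (A `|` B)%fset = partial_sum x A + partial_sum x B.
Proof.
move=> AB; rewrite !partial_sumE (big_fsetID _ [in A]) /=; congr (_ + _).
  apply: eq_fbigl => i; rewrite !inE.
  by case: (i \in A); rewrite ?andbF.
apply: eq_fbigl => i; rewrite !inE.
case: (boolP (i \in A)) => iA /=; rewrite ?andbT//.
by apply/esym/negbTE; exact: (fdisjointP AB).
Qed.

Lemma partial_sumD (V : zmodType) (x y : I -> V) (A : {fset I}) :
  partial_sum (fun i => x i + y i) A = partial_sum x A + partial_sum y A.
Proof. by rewrite /partial_sum big_split. Qed.

Lemma partial_sumZ (K : pzRingType) (V : lmodType K) (a : K) (x : I -> V)
    (A : {fset I}) :
  partial_sum (fun i => a *: x i) A = a *: partial_sum x A.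
Proof. by rewrite /partial_sum scaler_sumr. Qed.

Lemma is_cvg_partial_sumD (V : normedModType R[i]) (x y : I -> V) :
  cvg (partial_sum x @ totally) -> cvg (partial_sum y @ totally) ->
  cvg (partial_sum (fun i => x i + y i) @ totally).
Proof.
move=> cx cy; rewrite (_ : partial_sum _ = partial_sum x \+ partial_sum y).
  exact: is_cvgD.
by apply/funext => A; exact: partial_sumD.
Qed.

Lemma sumD (V : normedModType R[i]) (x y : I -> V) :
  cvg (partial_sum x @ totally) -> cvg (partial_sum y @ totally) ->
  sum (fun i => x i + y i) = sum x + sum y.
Proof.
move=> cx cy; rewrite /sum -limD//.
by congr (lim (_ @ totally)); apply/funext => A; exact: partial_sumD.
Qed.

Lemma is_cvg_partial_sumZ (V : normedModType R[i]) (a : R[i]) (x : I -> V) :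
  cvg (partial_sum x @ totally) ->
  cvg (partial_sum (fun i => a *: x i) @ totally).
Proof.
move=> cx; rewrite (_ : partial_sum _ = a \*: partial_sum x).
  exact: is_cvgZr.
by apply/funext => A; exact: partial_sumZ.
Qed.

Lemma partial_sum_linear (V W : lmodType R[i]) (f : V -> W) (x : I -> V)
    (A : {fset I}) : linear f ->
  f (partial_sum x A) = partial_sum (f \o x) A.
Proof.
move=> lf; rewrite /partial_sum; elim/big_ind2 : _ => // [|u1 v1 u2 v2 <- <-].
  exact: linear_map0.
exact: linear_mapD.
Qed.

(** Enlarging [A] by a fixed finite set [A0] brings the sum within 1 of the limit, and the added
    terms cost at most the sum of the norms over [A0]. *)
Lemma partial_sum_bounded (V : normedModType R[i]) (x : I -> V) :
  cvg (partial_sum x @ totally) ->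
  exists c : R, forall A, rnorm (partial_sum x A) <= c.
Proof.
move=> /cvg_ex[l xl]; have /cvg_rnormP/(_ 1 ltr01)[A0 _ A0P] := xl.
exists (rnorm l + 1 + \sum_(i <- A0) rnorm (x i)) => A.
have A0A : rnorm (l - partial_sum x (A `|` A0)%fset) < 1.
  by apply: A0P; rewrite /= fsubsetUr.
have : partial_sum x (A `|` A0)%fset
    = partial_sum x A + partial_sum x (A0 `\` A)%fset.
  rewrite -partial_sumU; last first.
    by apply/fdisjointP => i iA; rewrite !inE iA.
  congr partial_sum; apply/fsetP => i; rewrite !inE.
  by case: (i \in A).
move=> /esym/(canRL (addrK _)) ->.
apply: le_trans (ler_rnormB _ _) _; apply: lerD.
  have := ler_rnormB l (l - partial_sum x (A `|` A0)%fset).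
  by rewrite opprB addrC subrK; lra.
rewrite partial_sumE.
apply: (@le_trans _ _ (\sum_(i <- (A0 `\` A)%fset) rnorm (x i))).
  elim/big_ind2 : _ => [|u a v b ua vb|//]; first by rewrite rnorm0.
  by rewrite (le_trans (ler_rnormD _ _))// lerD.
rewrite [leRHS](big_fsetID _ [in A]) /= [leRHS]addrC.
rewrite (_ : [fset i in A0 | _]%fset = (A0 `\` A)%fset); last first.
  by apply/fsetP => i; rewrite !inE andbC.
by rewrite lerDl sumr_ge0// => i _; exact: rnorm_ge0.
Qed.

Lemma weakly_unconditional_cvg (E : hilbertType R[i]) (x : I -> E) :
  (forall y, cvg (partial_sum (fun i => hinner (x i) y : R[i]^o) @ totally)) ->
  cvg (partial_sum x @ totally).
Proof.
move=> xy.
have sumE y A : hinner (partial_sum x A) y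
    = partial_sum (fun i => hinner (x i) y : R[i]^o) A.
  have lin : linear (fun u : E => hinner u y : R[i]^o).
    by move=> a u v; rewrite hinnerDl hinnerZl.
  by rewrite (partial_sum_linear _ _ lin).
have [y|c c0 cP] := @uniform_boundedness R E (range (partial_sum x)).
  have [c cy] := partial_sum_bounded (xy y); exists c => _ [A _ <-].
  by rewrite rnorm_hinnerC sumE.
apply: cauchy_cvg; apply: cauchy_exP => e e0.
have eE : e = (complex.Re e)%:C%C by rewrite RRe_real// gtr0_real.
set d := complex.Re e in eE; have d0 : 0 < d by rewrite -ltcR -eE.
(* Cauchy criterion in block form: a set containing [A0] exceeds it by a block disjoint from
   [A0]. *)
suff [A0 A0P] : exists A0 : {fset I}, forall F, [disjoint A0 & F]%fset ->
    rnorm (partial_sum x F) < d.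
  exists (partial_sum x A0); exists A0 => // B /= A0B.
  rewrite -ball_normE /= eE rnormE ltcR rdistC.
  have -> : B = (A0 `|` (B `\` A0))%fset.
    apply/fsetP => i; rewrite !inE.
    by case: (boolP (i \in A0)) => [/(fsubsetP A0B) ->|].
  have dj : [disjoint A0 & B `\` A0]%fset.
    by apply/fdisjointP => i iA; rewrite !inE iA.
  by rewrite partial_sumU// addrAC subrr add0r A0P.
apply: contrapT => noA0.
have blocks (A0 : {fset I}) :
    exists F, [disjoint A0 & F]%fset /\ d <= rnorm (partial_sum x F).
  apply: contrapT => noF; apply: noA0; exists A0 => F A0F.
  by rewrite ltNge; apply/negP => dF; apply: noF; exists F.
(* [A] and [B] collect the blocks taken with plus and with minus sign. By the parallelogram law one
   of [a + b], [a - b] has squared norm at least [|a|^2 + |b|^2], so each new block adds at least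
   [d ^+ 2]. *)
have grow n : exists A B : {fset I},
    n%:R * d ^+ 2 <= rnorm (partial_sum x A - partial_sum x B) ^+ 2.
  elim: n => [|n [A [B AB]]].
    by exists fset0%fset, fset0%fset; rewrite mul0r sqr_ge0.
  have [F [ABF dF]] := blocks (A `|` B)%fset.
  have AF : [disjoint A & F]%fset by move: ABF; rewrite fdisjointUX => /andP[].
  have BF : [disjoint B & F]%fset by move: ABF; rewrite fdisjointUX => /andP[].
  set a := partial_sum x A - partial_sum x B in AB.
  set b := partial_sum x F in dF.
  have dF2 : d ^+ 2 <= rnorm b ^+ 2.
    by rewrite ler_sqr ?nnegrE ?rnorm_ge0// ltW.
  have ab := parallelogram a b.
  rewrite -natr1 mulrDl mul1r.
  have [le|lt] := leP (n%:R * d ^+ 2 + d ^+ 2) (rnorm (a + b) ^+ 2).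
    by exists (A `|` F)%fset, B; rewrite partial_sumU// addrAC.
  exists A, (B `|` F)%fset; rewrite partial_sumU// opprD addrA.
  by rewrite -/a -/b; lra.
(* A difference of two partial sums has norm at most [2 * c], so this many blocks are too many. *)
pose n := (Num.truncn ((2 * c) ^+ 2 / d ^+ 2)).+1.
have [A [B]] := grow n; apply/negP; rewrite -ltNge.
apply: (@le_lt_trans _ _ ((2 * c) ^+ 2)); last first.
  by rewrite -ltr_pdivrMr ?exprn_gt0// truncnS_gt.
rewrite ler_sqr ?nnegrE ?rnorm_ge0 ?mulr_ge0//.
apply: le_trans (ler_rnormB _ _) _.
by rewrite mulr_natl mulr2n lerD// cP.
Qed.

End UnconditionalSums.

(** * Operators, closed subspaces and projections on a direct sum *)

Section DirectSums.
Variable R : realType.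
Implicit Types H X Z Y : hilbertType R[i].

Lemma hinner_hsum H X (z w : hsum H X) :
  hinner z w = hinner z.1 w.1 + hinner z.2 w.2.
Proof. by []. Qed.

Lemma sqr_rnorm_hsum H X (z : hsum H X) :
  rnorm z ^+ 2 = rnorm z.1 ^+ 2 + rnorm z.2 ^+ 2.
Proof. by apply: complexI; rewrite rmorphD /= -!hinner_rnorm. Qed.

Lemma rnorm_fst_le H X (z : hsum H X) : rnorm z.1 <= rnorm z.
Proof.
by rewrite -ler_sqr ?nnegrE ?rnorm_ge0// sqr_rnorm_hsum lerDl sqr_ge0.
Qed.

Lemma rnorm_snd_le H X (z : hsum H X) : rnorm z.2 <= rnorm z.
Proof.
by rewrite -ler_sqr ?nnegrE ?rnorm_ge0// sqr_rnorm_hsum lerDr sqr_ge0.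
Qed.

Lemma rnorm_hsum_le H X (z : hsum H X) : rnorm z <= rnorm z.1 + rnorm z.2.
Proof.
rewrite -ler_sqr ?nnegrE ?addr_ge0 ?rnorm_ge0// sqr_rnorm_hsum sqrrD addrAC.
by rewrite lerDl mulrn_wge0// mulr_ge0 ?rnorm_ge0.
Qed.

Lemma hsum_cvg H X (T : Type) (F : set_system T) {FF : Filter F}
    (f : T -> H) (g : T -> X) a b :
  f @ F --> a -> g @ F --> b ->
  (fun t => (f t, g t) : hsum H X) @ F --> ((a, b) : hsum H X).
Proof.
move=> /cvg_rnormP fa /cvg_rnormP gb; apply/cvg_rnormP => e e0.
have e2 : 0 < e / 2 by rewrite divr_gt0.
apply: filterS2 (fa _ e2) (gb _ e2) => t lt1 lt2.
by apply: le_lt_trans (rnorm_hsum_le _) _ => /=; lra.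
Qed.

Lemma bounded_opsum H X Z Y (T : H -> Z) (U : X -> Y) :
  bounded_op T -> bounded_op U -> bounded_op (opsum T U).
Proof.
move=> /bounded_opP[lT [c c0 Tc]] /bounded_opP[lU [d d0 Ud]].
apply/bounded_opP; split=> [a x y|].
  by rewrite /opsum /= lT lU.
exists (c + d) => [|z]; first exact: addr_ge0.
apply: le_trans (rnorm_hsum_le _) _; rewrite mulrDl; apply: lerD => /=.
  by apply: le_trans (Tc _) _; rewrite ler_wpM2l// rnorm_fst_le.
by apply: le_trans (Ud _) _; rewrite ler_wpM2l// rnorm_snd_le.
Qed.

Lemma adjoint_opsum H X Z Y (T : H -> Z) (U : X -> Y) :
  bounded_op T -> bounded_op U ->
  adjoint (opsum T U) = opsum (adjoint T) (adjoint U).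
Proof.
move=> bT bU; apply: adjoint_unique => [|x y]; first exact: bounded_opsum.
by rewrite !hinner_hsum /= (adjointP _ _ bT) (adjointP _ _ bU).
Qed.

Lemma invertible_opsum H X (T : H -> H) (U : X -> X) :
  invertible_op T -> invertible_op U -> invertible_op (opsum T U).
Proof.
move=> [bT [T' [bT' TT' T'T]]] [bU [U' [bU' UU' U'U]]].
split; first exact: bounded_opsum.
exists (opsum T' U'); split=> [|[x y]|[x y]]; first exact: bounded_opsum.
  by rewrite /opsum /= TT' UU'.
by rewrite /opsum /= T'T U'U.
Qed.

Lemma bijective_opsum H X Z Y (T : H -> Z) (U : X -> Y) :
  bijective T -> bijective U -> bijective (opsum T U).
Proof.
move=> [T' TT' T'T] [U' UU' U'U]; exists (opsum T' U') => -[x y].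
  by rewrite /opsum /= TT' UU'.
by rewrite /opsum /= T'T U'U.
Qed.

Lemma closed_subspace_setsum H X (M : set H) (N : set X) :
  closed_subspace M -> closed_subspace N -> closed_subspace (setsum M N).
Proof.
move=> cM cN; split; last 2 first.
- by split; exact: closed_subspace0.
- by move=> a x y [? ?] [? ?]; split; exact: closed_subspaceP.
have -> : setsum M N = (fst : hsum H X -> H) @^-1` M
    `&` (snd : hsum H X -> X) @^-1` N by [].
have [[clM _ _] [clN _ _]] := (cM, cN).
apply: closedI; apply: closed_comp => // z _.
  apply: (@rbounded_continuous R (hsum H X) H fst 1) => // x.
  by rewrite mul1r rnorm_fst_le.
apply: (@rbounded_continuous R (hsum H X) X snd 1) => // x.
by rewrite mul1r rnorm_snd_le.
Qed.

Lemma orth_proj_setsum H X (M : set H) (N : set X) :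
  closed_subspace M -> closed_subspace N ->
  orth_proj (setsum M N) = opsum (orth_proj M) (orth_proj N).
Proof.
move=> cM cN; apply/funext => z; apply: orth_proj_unique.
- exact: closed_subspace_setsum.
- by split; [exact: (orth_projP _ cM).1|exact: (orth_projP _ cN).1].
- move=> m [Mm Nm]; rewrite hinner_hsum /=.
  by rewrite (orth_projP _ cM).2// (orth_projP _ cN).2// addr0.
Qed.

End DirectSums.

(** * Polarization, and the form and series of one family with their transport by [w] *)

Lemma polarization (R : realType) (E F : hilbertType R[i]) (L L' : E -> F) e g :
  linear L -> linear L' ->
  let q x := hinner (L x) (L' x) in
  hinner (L e) (L' g) = 4^-1 * (q (e + g) + (-1 * q (e - g)
    + ('i * q (e + 'i *: g) + - 'i * q (e - 'i *: g)))).
Proof.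
move=> lL lL' q; rewrite /q.
rewrite !(linear_mapD lL, linear_mapN lL, linear_mapZ lL).
rewrite !(linear_mapD lL', linear_mapN lL', linear_mapZ lL').
rewrite !(hinnerDl, hinnerDr, hinnerNl, hinnerNr, hinnerZl, hinnerZr) conjCi.
have := sqrCi R[i]; rewrite expr2; move: ('i : R[i]) => j jj.
by field: jj.
Qed.

Section Frames.
Variables (R : realType) (E : hilbertType R[i]) (I : choiceType).
Variables (Q Q' : E -> E) (M : I -> set E).
Variables (Z : I -> hilbertType R[i]) (Theta : forall i, E -> Z i).
Variable v : I -> R.
Hypotheses (bQ : bounded_op Q) (bQ' : bounded_op Q').
Hypothesis cM : forall i, closed_subspace (M i).
Hypothesis bTheta : forall i, bounded_op (Theta i).

Let bL i (P : E -> E) : bounded_op P ->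
  bounded_op (Theta i \o orth_proj (M i) \o P).
Proof.
move=> bP; apply: bounded_op_comp => //; apply: bounded_op_comp => //.
exact: bounded_orth_proj.
Qed.

(** The weak terms of the frame series form a sesquilinear expression whose diagonal [g = e] is
    [frame_form]. *)
Lemma hinner_frame_series e g i : hinner (frame_series Q Q' M Theta v e i) g
  = (v i)%:C%C ^+ 2 * hinner (Theta i (orth_proj (M i) (Q' e)))
                             (Theta i (orth_proj (M i) (Q g))).
Proof.
by rewrite /frame_series hinnerZl -adjointPr// orth_proj_adj// -adjointPr.
Qed.

(** The hypothesis concerns diagonal values only. Polarization writes each weak term as a
    combination of four of them, valid for different [Q] and [Q'] since the scalars are complex, and
    weak unconditional convergence yields norm convergence. *)
Lemma frame_series_cvg :
  (forall e, cvg (partial_sum (frame_form Q Q' M Theta v e) @ totally)) ->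
  forall e, cvg (partial_sum (frame_series Q Q' M Theta v e) @ totally).
Proof.
move=> cvgq e; apply: weakly_unconditional_cvg => g.
pose q f := frame_form Q Q' M Theta v f : I -> R[i]^o.
have -> : (fun i => hinner (frame_series Q Q' M Theta v e i) g : R[i]^o) =
  (fun i => 4^-1 *: (q (e + g) i + ((-1) *: q (e - g) i
    + ('i *: q (e + 'i *: g) i + (- 'i) *: q (e - 'i *: g) i)))).
  apply/funext => i; rewrite hinner_frame_series /q /frame_form.
  pose L := Theta i \o orth_proj (M i) \o Q'.
  pose L' := Theta i \o orth_proj (M i) \o Q.
  have lL : linear L by exact: bounded_op_linear (bL i bQ').
  have lL' : linear L' by exact: bounded_op_linear (bL i bQ).
  have := polarization e g lL lL'; rewrite /L /L' /= => ->.
  rewrite /GRing.scale /=; ring.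
apply: is_cvg_partial_sumZ; apply: is_cvg_partial_sumD; first exact: cvgq.
apply: is_cvg_partial_sumD; first exact/is_cvg_partial_sumZ/cvgq.
by apply: is_cvg_partial_sumD; exact/is_cvg_partial_sumZ/cvgq.
Qed.

Variable w : E -> E.
Hypotheses (bw : bounded_op w) (cwM : forall i, closed_subspace (w @` M i)).
Hypotheses (wQ : adjoint w \o Q = Q \o adjoint w).
Hypotheses (wQ' : adjoint w \o Q' = Q' \o adjoint w).

Lemma orth_proj_adjoint_image i x :
  orth_proj (M i) (adjoint w (orth_proj (w @` M i) x))
  = orth_proj (M i) (adjoint w x).
Proof.
have lA := bounded_op_linear (bounded_adjoint bw).
apply/esym/eqP; rewrite -subr_eq0 -(linear_mapB (orth_proj_linear (cM i))).
rewrite -(linear_mapB lA); apply/eqP; apply: orth_proj_unique => //.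
  exact: closed_subspace0.
(* Pairing with [m] in [M] becomes pairing the residual of [x] with [w m], to which it is
   orthogonal. *)
by move=> m Mm; rewrite subr0 -adjointPr// (orth_projP _ (cwM i)).2.
Qed.

Let Theta' i := Theta i \o orth_proj (M i) \o adjoint w.

Lemma frame_form_image e i :
  frame_form Q Q' (fun i => w @` M i) Theta' v e i
  = frame_form Q Q' M Theta v (adjoint w e) i.
Proof.
rewrite /frame_form /Theta' /= !orth_proj_adjoint_image.
have := congr1 (@^~ e) wQ => /= ->.
by have := congr1 (@^~ e) wQ' => /= ->.
Qed.

(** Tested against [g], the outer [w] becomes [adjoint w] on [g]; both sides then reduce to the same
    sesquilinear expression at [adjoint w e] and [adjoint w g]. *)
Lemma frame_series_image e i :
  frame_series Q Q' (fun i => w @` M i) Theta' v e i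
  = w (frame_series Q Q' M Theta v (adjoint w e) i).
Proof.
have bT' : bounded_op (Theta' i) by exact/bL/bounded_adjoint.
have bA := bounded_adjoint bw.
apply: hinner_ext => g; rewrite adjointP// hinner_frame_series.
rewrite /frame_series hinnerZl -adjointPr// orth_proj_adj// -adjointPr//.
rewrite /Theta' /= !orth_proj_adjoint_image.
have := congr1 (@^~ e) wQ' => /= ->.
by have := congr1 (@^~ g) wQ => /= ->.
Qed.

End Frames.

(** * Forms and series of the direct sum of two families *)

Section DirectSumFrames.
Variables (R : realType) (H X : hilbertType R[i]) (I : choiceType).
Variables (Hi Xi : I -> hilbertType R[i]) (M : I -> set H) (N : I -> set X).
Variables (Lambda : forall i, H -> Hi i) (Gamma : forall i, X -> Xi i).
Variables (v : I -> R) (T T1 : H -> H) (U U1 : X -> X).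
Hypotheses (bT : bounded_op T) (bU : bounded_op U).
Hypotheses (cM : forall i, closed_subspace (M i)).
Hypotheses (cN : forall i, closed_subspace (N i)).
Hypotheses (bLambda : forall i, bounded_op (Lambda i)).
Hypotheses (bGamma : forall i, bounded_op (Gamma i)).

Lemma frame_form_opsum z i :
  frame_form (opsum T U) (opsum T1 U1) (fun i => setsum (M i) (N i))
    (fun i => opsum (Lambda i) (Gamma i)) v z i
  = frame_form T T1 M Lambda v z.1 i + frame_form U U1 N Gamma v z.2 i.
Proof. by rewrite /frame_form !orth_proj_setsum// hinner_hsum mulrDr. Qed.

Lemma frame_series_opsum z i :
  frame_series (opsum T U) (opsum T1 U1) (fun i => setsum (M i) (N i))
    (fun i => opsum (Lambda i) (Gamma i)) v z i
  = (frame_series T T1 M Lambda v z.1 i, frame_series U U1 N Gamma v z.2 i).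
Proof. by rewrite /frame_series !orth_proj_setsum// !adjoint_opsum. Qed.

End DirectSumFrames.

(** * Frame bounds and frame operator of the transported direct sum *)

Lemma partial_sum_pair (R : realType) (H X : hilbertType R[i]) (I : choiceType)
    (x : I -> H) (y : I -> X) (A : {fset I}) :
  partial_sum (fun i => (x i, y i) : hsum H X) A
  = (partial_sum x A, partial_sum y A).
Proof.
by rewrite /partial_sum; elim/big_ind3 : _ => // a b u c d t -> ->.
Qed.

(* [adjoint K \o adjoint w = adjoint w \o adjoint K], and [adjoint w] is bounded
   below. *)
Lemma rnorm_adjoint_commute (R : realType) (E : hilbertType R[i])
    (K w : E -> E) : bounded_op K -> bounded_op w -> bijective w ->
  K \o w = w \o K ->
  exists2 c : R, 0 <= c & forall e,
    rnorm (adjoint K e) <= c * rnorm (adjoint K (adjoint w e)).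
Proof.
move=> bK bw w_bij Kw.
have [[c c0 cw] _] := bijective_bounded_below bw w_bij; exists c => // e.
have := congr1 (fun f => adjoint f e) Kw.
by rewrite (adjoint_comp bK bw) (adjoint_comp bw bK) /= => <-.
Qed.

(** Supplies the lower frame bound, with [k] and [m] the norms compared in [rnorm_adjoint_commute].
    The [+ 1] keeps the denominator positive when [c = 0]. *)
Lemma scaled_sqr_le (R : realFieldType) (a A c k m : R) :
  0 < A -> a <= A / (c ^+ 2 + 1) -> 0 <= k -> k <= c * m ->
  a * k ^+ 2 <= A * m ^+ 2.
Proof.
move=> A0 aA k0 km; have c1 : 0 < c ^+ 2 + 1 by rewrite ltr_wpDl// sqr_ge0.
apply: le_trans (ler_wpM2r (sqr_ge0 k) aA) _.
have km2 : k ^+ 2 <= (c ^+ 2 + 1) * m ^+ 2.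
  apply: (@le_trans _ _ ((c * m) ^+ 2)).
    by rewrite ler_sqr ?nnegrE// (le_trans k0).
  by rewrite exprMn ler_wpM2r ?sqr_ge0// lerDl.
have Ac : 0 <= A / (c ^+ 2 + 1) by rewrite divr_ge0 ?ltW.
apply: le_trans (ler_wpM2l Ac km2) _.
by rewrite mulrA divfK// gt_eqF.
Qed.

Lemma controlled_frame_bounds_cvg (R : realType) (E : hilbertType R[i])
    (I : choiceType) (Q Q' : E -> E) (M : I -> set E)
    (Z : I -> hilbertType R[i]) (Theta : forall i, E -> Z i) (v : I -> R)
    (K : E -> E) (a b : R) (e : E) :
  controlled_frame_bounds Q Q' M Theta v K a b ->
  partial_sum (frame_series Q Q' M Theta v e) @ totally
    --> frame_operator Q Q' M Theta v e.
Proof.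
move=> [[[bQ _] [bQ' _] _] MTheta _ _ fE].
apply: frame_series_cvg => //.
- by move=> i; have [] := MTheta i.
- by move=> i; have [] := MTheta i.
- by move=> f; have [] := fE f.
Qed.

Theorem theorem3p8 (R : realType) (H X : hilbertType R[i])
  (sepH : separable H) (sepX : separable X)
  (J : set int) (Hj Xj : J -> hilbertType R[i])
  (Wj : J -> set H) (Vj : J -> set X)
  (Lambda : forall j : J, H -> Hj j) (Gamma : forall j : J, X -> Xj j)
  (v : J -> R)
  (K1 T T1 : H -> H) (K2 U U1 : X -> X)
  (hK1 : bounded_op K1) (hK2 : bounded_op K2)
  (hT : invertible_op T) (hT1 : invertible_op T1)
  (hU : invertible_op U) (hU1 : invertible_op U1)
  (A B C D : R)
  (hLambda : controlled_frame_bounds T T1 Wj Lambda v K1 A B)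
  (hGamma : controlled_frame_bounds U U1 Vj Gamma v K2 C D)
  (W : H -> H) (V : X -> X)
  (hW : bounded_op W) (W_inv : bijective W)
  (hV : bounded_op V) (V_inv : bijective V)
  (WT : adjoint W \o T = T \o adjoint W)
  (WT1 : adjoint W \o T1 = T1 \o adjoint W)
  (VU : adjoint V \o U = U \o adjoint V)
  (VU1 : adjoint V \o U1 = U1 \o adjoint V)
  (K1W : K1 \o W = W \o K1) (K2V : K2 \o V = V \o K2) :
  let S_C := frame_operator T T1 Wj Lambda v in
  let S_C' := frame_operator U U1 Vj Gamma v in
  let Deltaj (j : J) : set (hsum H X) :=
    opsum W V @` setsum (Wj j) (Vj j) in
  let Theta (j : J) : hsum H X -> hsum (Hj j) (Xj j) :=
    opsum (Lambda j) (Gamma j) \o orth_proj (setsum (Wj j) (Vj j))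
      \o opsum (adjoint W) (adjoint V) in
  [/\ controlled_frame (opsum T U) (opsum T1 U1) Deltaj Theta v (opsum K1 K2),
      forall z, cvg (partial_sum
        (frame_series (opsum T U) (opsum T1 U1) Deltaj Theta v z) @ totally)
    & frame_operator (opsum T U) (opsum T1 U1) Deltaj Theta v =
      opsum W V \o opsum S_C S_C' \o adjoint (opsum W V)].
Proof.
move=> S_C S_C' Deltaj Theta.
have [_ WL A0 AB fH] := hLambda; have [_ VG C0 CD fX] := hGamma.
have cW j : closed_subspace (Wj j) by have [] := WL j.
have cV j : closed_subspace (Vj j) by have [] := VG j.
have bL j : bounded_op (Lambda j) by have [] := WL j.
have bG j : bounded_op (Gamma j) by have [] := VG j.
have [[bT _] [bT1 _] [bU _] [bU1 _]] := And4 hT hT1 hU hU1.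
have bTU : bounded_op (opsum T U) by exact: bounded_opsum.
have bTU1 : bounded_op (opsum T1 U1) by exact: bounded_opsum.
set w : hsum H X -> hsum H X := opsum W V.
have bw : bounded_op w by exact: bounded_opsum.
have aw : adjoint w = opsum (adjoint W) (adjoint V) by exact: adjoint_opsum.
have cWV j : closed_subspace (setsum (Wj j) (Vj j)).
  exact: closed_subspace_setsum.
have bLG j : bounded_op (opsum (Lambda j) (Gamma j)) by exact: bounded_opsum.
(* The image subspaces are closed because the bounded inverse theorem makes [w] bounded below. *)
have cD j : closed_subspace (Deltaj j).
  have w_bij : bijective w by exact: bijective_opsum.
  have [_ [c _ cw]] := bijective_bounded_below bw w_bij.
  exact: closed_subspace_image bw cw (cWV j).
have wTU : adjoint w \o opsum T U = opsum T U \o adjoint w.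
  rewrite aw; apply/funext => -[f g]; congr pair.
    exact: (congr1 (@^~ f) WT).
  exact: (congr1 (@^~ g) VU).
have wTU1 : adjoint w \o opsum T1 U1 = opsum T1 U1 \o adjoint w.
  rewrite aw; apply/funext => -[f g]; congr pair.
    exact: (congr1 (@^~ f) WT1).
  exact: (congr1 (@^~ g) VU1).
have formE z : frame_form (opsum T U) (opsum T1 U1) Deltaj Theta v z =
    (fun j => frame_form T T1 Wj Lambda v (adjoint W z.1) j
            + frame_form U U1 Vj Gamma v (adjoint V z.2) j).
  apply/funext => j; rewrite /Theta -aw.
  by rewrite frame_form_image// frame_form_opsum// aw.
have seriesE z A' :
    partial_sum (frame_series (opsum T U) (opsum T1 U1) Deltaj Theta v z) A'
  = w (partial_sum (frame_series T T1 Wj Lambda v (adjoint W z.1)) A',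
       partial_sum (frame_series U U1 Vj Gamma v (adjoint V z.2)) A').
  rewrite -partial_sum_pair (partial_sum_linear _ _ (bounded_op_linear bw)).
  congr (partial_sum _ A'); apply/funext => j.
  rewrite /Theta -aw frame_series_image//.
  rewrite [frame_series _ _ _ _ _ (adjoint w z) j]frame_series_opsum//.
  by rewrite aw.
(* The two component series converge in norm and [w] is continuous, so the finite identity passes to
   the limit; this gives both the convergence and the operator formula. *)
have seriesP z :
    partial_sum (frame_series (opsum T U) (opsum T1 U1) Deltaj Theta v z)
      @ totally --> w (S_C (adjoint W z.1), S_C' (adjoint V z.2)).
  rewrite (funext (seriesE z)).
  apply: (@cvg_comp _ _ _ (fun A' : {fset J} =>
    (partial_sum (frame_series T T1 Wj Lambda v (adjoint W z.1)) A',
     partial_sum (frame_series U U1 Vj Gamma v (adjoint V z.2)) A')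
      : hsum H X)).
    by apply: hsum_cvg; apply: controlled_frame_bounds_cvg; eassumption.
  exact: bounded_op_continuous.
split; last 2 first.
- by move=> z; apply/cvg_ex; eexists; exact: seriesP.
- apply/funext => z; rewrite /= aw; apply: cvg_lim (seriesP z).
  exact: norm_hausdorff.
have [c1 _ c1P] := rnorm_adjoint_commute hK1 hW W_inv K1W.
have [c2 _ c2P] := rnorm_adjoint_commute hK2 hV V_inv K2V.
have /bounded_opP[_ [d1 d10 d1P]] := bounded_adjoint hW.
have /bounded_opP[_ [d2 d20 d2P]] := bounded_adjoint hV.
(* One lower bound has to serve both components, hence the minimum. In [b] the last summand [a]
   ensures [a <= b], and the others dominate the upper bounds of the two components. *)
pose a := Num.min (A / (c1 ^+ 2 + 1)) (C / (c2 ^+ 2 + 1)).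
pose b := B * d1 ^+ 2 + D * d2 ^+ 2 + a.
have a0 : 0 < a by rewrite lt_min !divr_gt0// ltr_wpDl// sqr_ge0.
have B0 : 0 < B by exact: lt_le_trans AB.
have D0 : 0 < D by exact: lt_le_trans CD.
exists a, b; split=> //.
- by split; [exact: invertible_opsum..|exact: bounded_opsum].
- move=> j; split=> //; last by have [] := WL j.
  apply: bounded_op_comp; last by rewrite -aw; exact: bounded_adjoint.
  by apply: bounded_op_comp => //; exact: bounded_orth_proj.
- by rewrite /b lerDr addr_ge0// mulr_ge0 ?sqr_ge0// ltW.
move=> z; have [cvgH /andP[lH uH]] := fH (adjoint W z.1).
have [cvgX /andP[lX uX]] := fX (adjoint V z.2).
have cvgHX := is_cvg_partial_sumD cvgH cvgX.
rewrite formE.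
split; first exact: cvgHX.
have -> := sumD cvgH cvgX.
rewrite adjoint_opsum//.
move: lH uH lX uX; rewrite !rnormE -!rmorphXn -!rmorphM /= => lH uH lX uX.
apply/andP; split.
  apply: le_trans (lerD lH lX); rewrite -rmorphD lecR.
  rewrite sqr_rnorm_hsum mulrDr /=; apply: lerD.
    apply: (scaled_sqr_le A0 _ _ (c1P _)); rewrite ?rnorm_ge0//.
    by rewrite ge_min lexx.
  apply: (scaled_sqr_le C0 _ _ (c2P _)); rewrite ?rnorm_ge0//.
  by rewrite ge_min lexx orbT.
apply: le_trans (lerD uH uX) _; rewrite -rmorphD lecR.
rewrite sqr_rnorm_hsum.
have sqW : rnorm (adjoint W z.1) ^+ 2 <= d1 ^+ 2 * rnorm z.1 ^+ 2.
  by rewrite -exprMn ler_sqr ?nnegrE ?mulr_ge0 ?rnorm_ge0.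
have sqV : rnorm (adjoint V z.2) ^+ 2 <= d2 ^+ 2 * rnorm z.2 ^+ 2.
  by rewrite -exprMn ler_sqr ?nnegrE ?mulr_ge0 ?rnorm_ge0.
rewrite mulrDr; apply: lerD.
  apply: le_trans (ler_wpM2l (ltW B0) sqW) _; rewrite mulrA.
  rewrite ler_wpM2r ?sqr_ge0// /b -addrA lerDl.
  by rewrite addr_ge0 ?mulr_ge0 ?sqr_ge0// ltW.
apply: le_trans (ler_wpM2l (ltW D0) sqV) _; rewrite mulrA.
rewrite ler_wpM2r ?sqr_ge0// /b addrAC lerDr.
by rewrite addr_ge0 ?mulr_ge0 ?sqr_ge0// ltW.
Qed.
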